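(* There exist constants $C_1,C_2>0$ such that the following holds. Let $p=p_n\in(0,1)$ be a sequence of probabilities, let $\mathcal{A}=R(n,p)$ be the random set system on $[n]$ with parameter $p$, and for integers $0\le m\le n$ let $X_m$ be the number of hitting sets of $\mathcal{A}$ of size $m$. Put $$\mathcal{F}=\mathcal{F}_n=[\,C_1\log\log n,\; n-C_2\log n\,],$$ $$\ell=\ell_n=\sup\{m=m_n:\lim_{n\to\infty}\mathbb{E}(X_m)=0\},\qquad h=h_n=\inf\{m=m_n:\lim_{n\to\infty}\mathbb{E}(X_m)=\infty\}.$$ Suppose that $p=p_n$ is suitable, meaning that $\ell$ and $h$ exist and that $\ell,h\in\mathcal{F}$ for all sufficiently large $n$. Then $h-\ell\in\{1,2\}$ for all sufficiently large $n$, and the minimum size $|H|$ of a hitting set of $\mathcal{A}$ satisfies $$|H|=\ell+1\quad\text{or}\quad |H|=h$$ with high probability, i.e. $\mathbb{P}(|H|\in\{\ell+1,h\})\to1$ as $n\to\infty$.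
   Context: For $n\ge1$ write $[n]=\{1,2,\dots,n\}$ and let $\mathcal{P}([n])$ be its power set. The random set system $R(n,p)$ is the random family $\mathcal{A}\subseteq\mathcal{P}([n])$ obtained by including each $A\in\mathcal{P}([n])$ independently with probability $p=p_n$. A set $S\subseteq[n]$ is a hitting set for $\mathcal{A}$ if $|A\cap S|\ge1$ for every $A\in\mathcal{A}$. $|H|$ denotes the minimum cardinality of a hitting set of $\mathcal{A}$; the event $|H|=k$ means that a hitting set of size $k$ exists and none of smaller size exists. (If $\emptyset\in\mathcal A$ there is no hitting set and no such event occurs.) One has $\mathbb{E}(X_m)=\binom{n}{m}(1-p)^{2^{n-m}}$. The sup and inf are over integer sequences $m=m_n$ with $0\le m_n\le n$, compared pointwise for all sufficiently large $n$: $\ell$ is the eventually largest sequence with $\mathbb{E}(X_{\ell_n})\to0$ (it has this property, and any sequence $m_n$ with this property satisfies $m_n\le\ell_n$ for all large $n$), and $h$ is the eventually smallest sequence with $\mathbb{E}(X_{h_n})\to\infty$ (it has this property, and any sequence $m_n$ with this property satisfies $m_n\ge h_n$ for all large $n$). *)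

(* Defs.v *)
From mathcomp Require Import all_boot all_order all_algebra.
From mathcomp Require Import all_classical all_reals all_analysis.

Set Implicit Arguments.
Unset Strict Implicit.
Unset Printing Implicit Defensive.

Import Order.TTheory GRing.Theory Num.Theory.
Import numFieldNormedType.Exports.

Local Open Scope classical_set_scope.
Local Open Scope ring_scope.

(* The ground set [n] = {1, ..., n} is represented by 'I_n = {0, ..., n-1}. *)
Notation set_family n := {set {set 'I_n}}.

Definition hitting (n : nat) (F : set_family n) (S : {set 'I_n}) : bool :=
  [forall A in F, (1 <= #|A :&: S|)%N].

Definition num_hitting (n m : nat) (F : set_family n) : nat :=
  #|[set S : {set 'I_n} | (#|S| == m) && hitting F S]%SET|.

(* The event |H| = k; it is false for every k when set0 \in F. *)
Definition min_hitting_size (n : nat) (F : set_family n) (k : nat) : bool :=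
  [exists S : {set 'I_n}, (#|S| == k) && hitting F S] &&
  ~~ [exists S : {set 'I_n}, (#|S| < k)%N && hitting F S].

(* The law of R(n, p): the product over all A of Bernoulli(p) weights. *)
Definition rss_mass (R : realType) (n : nat) (p : R) (F : set_family n) : R :=
  \prod_(A : {set 'I_n}) (if A \in F then p else 1 - p).

Definition rss_prob (R : realType) (n : nat) (p : R)
    (E : pred (set_family n)) : R :=
  \sum_(F : set_family n | E F) rss_mass p F.

Definition rss_expectation (R : realType) (n : nat) (p : R)
    (X : set_family n -> R) : R :=
  \sum_(F : set_family n) rss_mass p F * X F.

Definition EX (R : realType) (n : nat) (p : R) (m : nat) : R :=
  rss_expectation p (fun F : set_family n => (num_hitting m F)%:R).

Definition size_sequence (m : nat -> nat) : Prop := forall n, (m n <= n)%N.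

(* Suprema and infima of sets of sequences are taken with respect to the
   eventual pointwise order, and are required to be attained; they are thus
   determined only up to finitely many terms. *)
Definition is_ell (R : realType) (p : nat -> R) (l : nat -> nat) : Prop :=
  [/\ size_sequence l,
      EX n (p n) (l n) @[n --> \oo] --> (0 : R) &
      forall m : nat -> nat, size_sequence m ->
        EX n (p n) (m n) @[n --> \oo] --> (0 : R) ->
        \forall n \near \oo, (m n <= l n)%N].

Definition is_h (R : realType) (p : nat -> R) (h : nat -> nat) : Prop :=
  [/\ size_sequence h,
      EX n (p n) (h n) @[n --> \oo] --> +oo &
      forall m : nat -> nat, size_sequence m ->
        EX n (p n) (m n) @[n --> \oo] --> +oo ->
        \forall n \near \oo, (h n <= m n)%N].

Definition in_window (R : realType) (C1 C2 : R) (n k : nat) : Prop :=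
  C1 * ln (ln n%:R) <= k%:R <= n%:R - C2 * ln n%:R.

(* p is suitable, with l and h as the witnessing threshold sequences. *)
Definition suitable (R : realType) (C1 C2 : R) (p : nat -> R)
    (l h : nat -> nat) : Prop :=
  [/\ is_ell p l, is_h p h &
      \forall n \near \oo, in_window C1 C2 n (l n) /\ in_window C1 C2 n (h n)].

(* Main.v *)
Require Import Defs.
From mathcomp Require Import all_boot all_order all_algebra.
From mathcomp Require Import all_classical all_reals all_analysis.
From mathcomp Require Import zify ring lra.
Import Order.TTheory GRing.Theory Num.Theory.
Import numFieldNormedType.Exports.
Set Implicit Arguments.
Unset Strict Implicit.
Unset Printing Implicit Defensive.

(* Write mu_m = E X_m = C(n, m) (1 - p)^(2^(n - m)). Since
   mu_(m+1)^2 C(n, m) = C(n, m+1)^2 mu_m, inside the window mu_m >= 1 propagates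
   to mu_(m+1) >= 1, and mu_m > 1/n already forces mu_(m+1) >= n. The first fact
   gives l < h. Maximality of l, tested against the sequence that takes the
   value l + 1 whenever mu_(l+1) <= 1/n, gives mu_(l+1) > 1/n eventually, so
   mu_(l+2) tends to infinity and h <= l + 2.

   Whp no hitting set has size l, by Markov's inequality. For size h the second
   moment is a sum over pairs (S, T), where with j = |T \ S| the pair has weight
   (1 - p)^(2N - N / 2^j), N = 2^(n - h). As mu_h >= 1, the excess factor
   (1 - p)^(- N / 2^j) is at most C(n, h)^(1 / 2^j). Choose a cutoff J. For
   j >= J the factor is at most 1 + 1/M. For 0 < j < J it is at most
   C(n, h)^(1/2), while there are at most (h (n - h))^J such T, which is
   negligible against C(n, h)^(1/2). The lower end of the window, of order
   log log n, is what makes room for such a J. *)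

(** * Binomial estimates *)

(** Cut the exponent [a] into [d + 1] blocks of length [g]: [d] of them absorb [a ^ d], since
    [a <= (d + 1) 2 ^ g], and the last one absorbs the constants. *)
Lemma leq_mul_expn_expn2 (K d : nat) :
  exists a0, forall a, (a0 <= a)%N -> (K * a ^ d <= 2 ^ a)%N.
Proof.
exists (d.+1 * (K * d.+1 ^ d))%N => a a0_le.
set g := (a %/ d.+1)%N.
have g_ge : (K * d.+1 ^ d <= g)%N by rewrite leq_divRL // mulnC.
have a_le : (a <= d.+1 * 2 ^ g)%N.
  apply: leq_trans (_ : (d.+1 * g.+1 <= _)%N); last by rewrite leq_mul2l ltn_expl.
  by rewrite mulnC ltnW // ltn_ceil.
apply: leq_trans (_ : (K * (d.+1 * 2 ^ g) ^ d <= _)%N).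
  rewrite leq_mul2l; apply/orP; right.
  by have [d0|d_gt0] := posnP d; [rewrite d0 | rewrite leq_exp2r].
rewrite expnMn mulnA -expnM.
apply: leq_trans (_ : (2 ^ g * 2 ^ (g * d) <= _)%N).
  by rewrite leq_mul2r (leq_trans g_ge) ?orbT // ltnW // ltn_expl.
by rewrite -expnD -mulnS leq_exp2l // leq_divM.
Qed.

Lemma bin_leq_expn (n k : nat) : ('C(n, k) <= n ^ k)%N.
Proof.
elim: k => [|k IHk]; first by rewrite bin0.
apply: leq_trans (leq_pmull _ (ltn0Sn k)) _.
by rewrite mul_bin_left expnS leq_mul // leq_subr.
Qed.

(** After multiplication by [k!], powers and falling factorials compare factor by factor:
    [n (k - i) <= (n - i) k]. *)
Lemma expn_leq_bin (n k : nat) : (k <= n)%N -> (n ^ k <= 'C(n, k) * k ^ k)%N.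
Proof.
move=> k_le_n; rewrite -(leq_pmul2r (fact_gt0 k)) mulnAC bin_ffact -ffactnn.
elim: {1 3 4 6}k => [|i IHi]; first by rewrite !ffactn0.
rewrite !ffactnSr !expnSr mulnACA [leqRHS]mulnACA leq_mul //; nia.
Qed.

Lemma bin_leq_expn2 (n k : nat) : ('C(n, k) <= 2 ^ n)%N.
Proof.
have [k_le_n|/bin_small->//] := leqP k n.
rewrite -[2]/(1 + 1)%N expnDn (bigD1 (Ordinal (k_le_n : k < n.+1)%N)) //=.
by rewrite !exp1n !muln1 leq_addr.
Qed.

Lemma expn2_leq_bin (n k : nat) : (2 * k <= n)%N -> (2 ^ k <= 'C(n, k))%N.
Proof.
have [->|k_gt0] := posnP k; first by rewrite bin0.
move=> k_le; rewrite -(leq_pmul2r (_ : 0 < k ^ k)%N) ?expn_gt0 ?k_gt0 //.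
rewrite (leq_trans _ (@expn_leq_bin n k _)) //; last by lia.
by rewrite -expnMn leq_exp2r.
Qed.

(** * The window in integer form *)

(** The number of binary digits of [n >= 1], an integer stand-in for the logarithm; its value at 0
    is 1. *)
Definition bit_length (n : nat) : nat := (trunc_log 2 n).+1.

Lemma ltn_expn2_bit_length (n : nat) : (n < 2 ^ bit_length n)%N.
Proof. by case: n => [|n] //; exact: trunc_log_ltn. Qed.

Lemma expn2_bit_length_leq (n : nat) : (0 < n)%N -> (2 ^ (bit_length n).-1 <= n)%N.
Proof. exact: trunc_logP. Qed.

(* Integer form of the window: by the choice of the constants, sizes in the
   window satisfy (log n)^16 <= 2^min(k, n - k). *)
Definition inner_size (n k : nat) : bool :=
  (k <= n)%N && (bit_length n ^ 8 <= 2 ^ minn k (n - k))%N.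

(* J is the cutoff and L a bound on log_2 C(n, k) in the second moment argument:
   pairs with j >= J have excess factor at most 1 + 1/M, and the pairs with
   0 < j < J contribute at most a 1/M proportion. *)
Definition spread (M n k : nat) : Prop := exists J L : nat,
  [/\ (0 < J)%N, (0 < L)%N, ('C(n, k) <= 2 ^ L)%N, (L * M <= 2 ^ J)%N &
      (M ^ 2 * (k * (n - k)) ^ (2 * J) <= 'C(n, k))%N].

(** Once [n >= 2 ^ (2 ^ K)], the bit length of [n] exceeds [2 ^ K], and hence so does
    [2 ^ minn k (n - k)]. *)
Lemma bit_length_inner (K : nat) : exists n0, forall n k, (n0 <= n)%N ->
  inner_size n k -> (K <= bit_length n)%N /\ (K <= minn k (n - k))%N.
Proof.
exists (2 ^ (2 ^ K))%N => n k n0_le /andP[_ inner].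
have : (2 ^ K < bit_length n)%N.
  by rewrite -(ltn_exp2l _ _ (isT : 1 < 2)%N) (leq_ltn_trans n0_le) // ltn_expn2_bit_length.
have : (bit_length n <= bit_length n ^ 8)%N by rewrite -{1}(expn1 (bit_length n)) leq_pexp2l.
have := ltn_expl K (isT : 1 < 2)%N; move=> H1 H2 H3; split; first by lia.
by rewrite -(leq_exp2l _ _ (isT : 1 < 2)%N); lia.
Qed.

(* For small k take J = k / 4, comparing (k n)^(2J) with C(n, k) >= (n / k)^k. *)
Lemma spread_small (M : nat) : exists n0, forall n k, (n0 <= n)%N ->
  (2 * k <= n)%N -> inner_size n k -> (k ^ 4 <= n)%N ->
  spread M n k /\ (n ^ 6 <= 'C(n, k))%N.
Proof.
have [g0 g0P] := leq_mul_expn_expn2 (64 * M) 1.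
have [n0 n0P] := bit_length_inner (8 * (g0 + 8)).
(* The last condition of [spread] is proved after raising it to the fourth power, where [M ^ 8 <= n]
   removes [M]. *)
exists (n0 + M ^ 8 + 1)%N => n k n_ge kn inner k4n.
have [] := n0P _ _ _ inner; first by lia.
move: inner => /andP[_]; have -> : minn k (n - k) = k by lia.
set a := bit_length n => a8_le a_ge k_ge.
set J := (k %/ 4)%N.
have n_gt0 : (0 < n)%N by lia.
(* Fourth powers avoid fractional exponents: [k ^ 4 <= n] turns [C(n, k) >= (n / k) ^ k] into
   [C(n, k) >= n ^ (3 k / 4)]. *)
have C4 : (n ^ (3 * k) <= 'C(n, k) ^ 4)%N.
  rewrite -(leq_pmul2r (_ : 0 < (k ^ 4) ^ k)%N); last by rewrite !expn_gt0; lia.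
  apply: leq_trans (_ : n ^ (3 * k) * n ^ k <= _)%N.
    by rewrite leq_mul2l leq_exp2r ?k4n ?orbT //; lia.
  rewrite -expnD (_ : 3 * k + k = k * 4)%N; last by lia.
  rewrite -(expnM k) (mulnC 4) !expnM -expnMn leq_exp2r // expn_leq_bin //; lia.
have D_le : ((k * (n - k)) ^ 4 <= n ^ 5)%N.
  by rewrite expnMn expnS leq_mul // leq_exp2r // leq_subr.
split; last first.
  rewrite -(@leq_exp2r _ _ 4) // (leq_trans _ C4) // -expnM leq_exp2l; lia.
exists J, (a * k)%N; split; [rewrite /J; lia | by rewrite muln_gt0; lia | | |].
- apply: leq_trans (bin_leq_expn _ _) _; rewrite expnM leq_exp2r; last by lia.
  by rewrite ltnW // ltn_expn2_bit_length.
(* [2 ^ J] has room for two factors [2 ^ g]: the window gives [a <= 2 * 2 ^ g], and the second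
   factor absorbs [2 k M]. *)
- set g := (k %/ 8)%N.
  have a_le : (a <= 2 ^ g.+1)%N.
    rewrite -(@leq_exp2r _ _ 8) // (leq_trans a8_le) // -expnM leq_exp2l //; rewrite /g; lia.
  have kg : (k <= 16 * g)%N by rewrite /g; lia.
  have gM : (64 * M * g <= 2 ^ g)%N.
    by have := g0P g; rewrite expn1; apply; rewrite /g; lia.
  apply: leq_trans (_ : 2 ^ g * (2 * (k * M)) <= _)%N.
    by rewrite -mulnA (mulnA (2 ^ g)%N) -expnSr leq_mul2r a_le orbT.
  apply: leq_trans (_ : 2 ^ g * 2 ^ g <= _)%N.
    rewrite leq_mul2l (leq_trans _ gM) ?orbT //.
    by have := leq_mul kg (leqnn M); lia.
  by rewrite -expnD leq_exp2l // /J /g; lia.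
- rewrite -(@leq_exp2r _ _ 4) // (leq_trans _ C4) //.
  rewrite expnMn -!expnM (_ : 2 * J * 4 = 4 * (2 * J))%N; last by lia.
  rewrite (expnM _ 4); apply: leq_trans (_ : n * (n ^ 5) ^ (2 * J) <= _)%N.
    by rewrite leq_mul //; [lia | rewrite leq_exp2r //; rewrite /J; lia].
  by rewrite -expnM -expnS leq_exp2l // /J; lia.
Qed.

(* For large k, J of order log n suffices since C(n, k) >= 2^k. *)
Lemma spread_large (M : nat) : exists n0, forall n k, (n0 <= n)%N ->
  (2 * k <= n)%N -> inner_size n k -> (n < k ^ 4)%N ->
  spread M n k /\ (n ^ 6 <= 'C(n, k))%N.
Proof.
have [g0 g0P] := leq_mul_expn_expn2 (2 * 10 ^ 4) 8.
have [n0 n0P] := bit_length_inner (g0 + M + 1).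
exists (n0 + 2)%N => n k n_ge kn inner nk4.
have [] := n0P _ _ _ inner; first by lia.
have -> : minn k (n - k) = k by lia.
have n_gt0 : (0 < n)%N by lia.
have := ltn_expn2_bit_length n; have := expn2_bit_length_leq n_gt0.
set a := bit_length n => a_le a_gt a_ge k_ge.
have C2 := expn2_leq_bin kn.
(* In fourth powers: [10 ^ 4 a ^ 8 <= 2 ^ (a - 1) <= n < k ^ 4]. The 10 covers the exponent
   [2 M + 4 a (a + M)] met at the end, where [M <= a]. *)
have ka : (10 * a ^ 2 <= k)%N.
  rewrite -(@leq_exp2r _ _ 4) // ltnW //.
  have := g0P a; rewrite (_ : 8 = 2 * 4)%N // expnM -mulnA -expnMn => H.
  have : (2 ^ a = 2 * 2 ^ a.-1)%N by rewrite -expnS prednK //; lia.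
  by lia.
have aa : (a <= a ^ 2)%N by rewrite -mulnn leq_pmulr //; lia.
split; last first.
  apply: leq_trans C2; apply: leq_trans (_ : (2 ^ a) ^ 6 <= _)%N.
    by rewrite leq_exp2r // ltnW.
  by rewrite -expnM leq_exp2l //; lia.
exists (a + M)%N, n; split; try lia.
- exact: bin_leq_expn2.
- by rewrite expnD leq_mul ?(ltnW a_gt) // ltnW // ltn_expl.
- apply: leq_trans C2.
  apply: leq_trans (_ : (2 ^ M) ^ 2 * ((2 ^ a) ^ 2) ^ (2 * (a + M)) <= _)%N.
    apply: leq_mul; first by rewrite leq_exp2r // ltnW // ltn_expl.
    rewrite leq_exp2r; last by lia.
    by apply: leq_mul; rewrite ltnW //; [lia | apply: leq_ltn_trans a_gt; rewrite leq_subr].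
  rewrite -!expnM -expnD leq_exp2l //; nia.
Qed.

Lemma inner_sizeC (n k : nat) : inner_size n k -> inner_size n (n - k).
Proof.
by rewrite /inner_size => /andP[k_le]; rewrite leq_subr subKn // minnC.
Qed.

Lemma spreadC (M n k : nat) : (k <= n)%N -> spread M n (n - k) -> spread M n k.
Proof.
by rewrite /spread => k_le; rewrite bin_sub // subKn // (mulnC k).
Qed.

(** Both conclusions are symmetric under exchanging [k] and [n - k], so [2 k <= n] may be assumed.
    The first serves the second moment, the second the growth of the expectations. *)
Lemma spread_inner (M : nat) : exists n0, forall n k, (n0 <= n)%N ->
  inner_size n k -> spread M n k /\ (n ^ 6 <= 'C(n, k))%N.
Proof.
have [n1 n1P] := spread_small M; have [n2 n2P] := spread_large M.
exists (n1 + n2)%N => n k n_ge.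
wlog : k / (2 * k <= n)%N => [half|kn inner].
  have [/half//|nk inner] := leqP (2 * k) n.
  have /andP[k_le _] := inner.
  have [||sp Cn] := half (n - k)%N; [lia | exact: inner_sizeC |].
  by split; [exact: spreadC sp | rewrite bin_sub in Cn].
have [k4|k4] := leqP (k ^ 4) n; [apply: n1P | apply: n2P] => //; lia.
Qed.

(** * The random set system *)

Local Open Scope ring_scope.

Lemma rss_mass_ge0 (R : realType) (n : nat) (p : R) (F : set_family n) :
  0 <= p <= 1 -> 0 <= rss_mass p F.
Proof. by move=> /andP[p0 p1]; apply: prodr_ge0 => A _; case: ifP; lra. Qed.

Lemma rss_expectationE (R : realType) (n : nat) (p : R) (E : pred (set_family n)) :
  rss_expectation p (fun F => (E F)%:R) = rss_prob p E.
Proof.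
rewrite /rss_expectation /rss_prob [RHS]big_mkcond /=.
by apply: eq_bigr => F _; case: (E F); rewrite ?mulr1 ?mulr0.
Qed.

(** Expanding the product of the two-term sums gives one term per family [F]; a family meeting [U]
    has a zero factor. All hitting probabilities reduce to this one. *)
Lemma rss_prob_disjoint (R : realType) (n : nat) (p : R) (U : set_family n) :
  rss_prob p (fun F : set_family n => [disjoint F & U]) = (1 - p) ^+ #|U|.
Proof.
rewrite -rss_expectationE /rss_expectation.
transitivity (\prod_(A : {set 'I_n}) ((if A \in U then 0 else p) + (1 - p))).
  rewrite bigA_distr; apply: eq_bigr => F _; rewrite /rss_mass.
  have [dis|/pred0Pn[A /andP[/= AF AU]]] := boolP [disjoint F & U]; last first.
    by rewrite mulr0 (bigD1 A) //= AF AU mul0r.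
  rewrite mulr1; apply: eq_bigr => A _; case: ifP => // AF.
  by rewrite (disjointFr dis AF).
rewrite -prodr_const [RHS]big_mkcond; apply: eq_bigr => A _.
by case: ifP => _; rewrite ?add0r // addrC subrK.
Qed.

Lemma sum_rss_mass (R : realType) (n : nat) (p : R) :
  \sum_(F : set_family n) rss_mass p F = 1.
Proof.
rewrite -[RHS](expr0 (1 - p)) -(@cards0 {set 'I_n}) -rss_prob_disjoint /rss_prob.
by apply: eq_bigl => F; rewrite disjoint_sym finset.disjoints_subset finset.sub0set.
Qed.

Lemma rss_prob_le1 (R : realType) (n : nat) (p : R) (E : pred (set_family n)) :
  0 < p < 1 -> rss_prob p E <= 1.
Proof.
move=> p01; rewrite -(sum_rss_mass n p) /rss_prob big_mkcond.
by apply: ler_sum => F _; case: ifP => // _; apply: rss_mass_ge0; move: p01; lra.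
Qed.

(** A set misses [S] exactly when it lies in the complement, so hitting means avoiding a fixed
    family of [2 ^ (n - #|S|)] sets. *)
Lemma hittingE (n : nat) (F : set_family n) (S : {set 'I_n}) :
  hitting F S = [disjoint F & powerset (~: S)].
Proof.
rewrite /hitting disjoint_subset; apply/forall_inP/fintype.subsetP => hit A /hit.
  by rewrite card_gt0 !inE -finset.disjoints_subset finset.setI_eq0.
by rewrite card_gt0 !inE -finset.disjoints_subset finset.setI_eq0.
Qed.

(** Inclusion-exclusion for the two forbidden power sets, which meet in the power set of the
    complement of [S :|: T]. *)
Lemma rss_prob_hitting2 (R : realType) (n : nat) (p : R) (S T : {set 'I_n}) :
  rss_prob p (fun F : set_family n => hitting F S && hitting F T) =
  (1 - p) ^+ (2 ^ (n - #|S|) + 2 ^ (n - #|T|) - 2 ^ (n - #|S :|: T|)).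
Proof.
have cardC (A : {set 'I_n}) : #|~: A| = (n - #|A|)%N.
  by rewrite cardsCs finset.setCK card_ord.
rewrite -!cardC -!card_powerset finset.setCU finset.powersetI -cardsU -rss_prob_disjoint.
by apply: eq_bigl => F; rewrite !hittingE -!finset.setI_eq0 finset.setIUr finset.setU_eq0.
Qed.

Lemma rss_prob_hitting (R : realType) (n : nat) (p : R) (S : {set 'I_n}) :
  rss_prob p (fun F : set_family n => hitting F S) = (1 - p) ^+ (2 ^ (n - #|S|)).
Proof.
transitivity (rss_prob p (fun F : set_family n => hitting F S && hitting F S)).
  by apply: eq_bigl => F; rewrite andbb.
by rewrite rss_prob_hitting2 finset.setUid addnK.
Qed.

Lemma num_hittingE (R : realType) (n m : nat) (F : set_family n) :
  (num_hitting m F)%:R = \sum_(S : {set 'I_n} | #|S| == m) (hitting F S)%:R :> R.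
Proof.
rewrite /num_hitting -sum1_card natr_sum [LHS]big_mkcond [RHS]big_mkcond /=.
by apply: eq_bigr => S _; rewrite inE; case: eqP => //= _; case: hitting.
Qed.

Lemma card_sized_sets (T : finType) (m : nat) :
  #|[set S : {set T} | #|S| == m]%SET| = 'C(#|T|, m).
Proof.
rewrite -cardsT -cards_draws; apply: eq_card => S.
by rewrite !inE finset.subsetT.
Qed.

Lemma EX_E (R : realType) (n m : nat) (p : R) :
  EX n p m = 'C(n, m)%:R * (1 - p) ^+ (2 ^ (n - m)).
Proof.
rewrite /EX /rss_expectation.
under eq_bigr do rewrite num_hittingE mulr_sumr.
rewrite exchange_big /= (eq_bigr (fun=> (1 - p) ^+ (2 ^ (n - m)))); last first.
  by move=> S /eqP <-; rewrite -rss_prob_hitting -rss_expectationE.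
by rewrite sumr_const -cardsE card_sized_sets card_ord mulr_natl.
Qed.

Lemma second_moment_E (R : realType) (n m : nat) (p : R) :
  rss_expectation p (fun F : set_family n => (num_hitting m F)%:R ^+ 2) =
  \sum_(S : {set 'I_n} | #|S| == m) \sum_(T : {set 'I_n} | #|T| == m)
    (1 - p) ^+ (2 ^ (n - m) + 2 ^ (n - m) - 2 ^ (n - #|S :|: T|)).
Proof.
rewrite /rss_expectation.
under eq_bigr => F _ do rewrite num_hittingE expr2 big_distrlr /= mulr_sumr.
rewrite exchange_big /=; apply: eq_bigr => S /eqP Sm.
under eq_bigr do rewrite mulr_sumr.
rewrite exchange_big /=; apply: eq_bigr => T /eqP Tm.
rewrite -{1}Sm -Tm -rss_prob_hitting2 -rss_expectationE.
by apply: eq_bigr => F _; rewrite -natrM mulnb.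
Qed.

(** Chebyshev's inequality, multiplied out to avoid dividing by the mean. *)
Lemma rss_prob_num_hitting_eq0 (R : realType) (n m : nat) (p : R) : 0 <= p <= 1 ->
  rss_prob p (fun F : set_family n => num_hitting m F == 0%N) * EX n p m ^+ 2 <=
  rss_expectation p (fun F : set_family n => (num_hitting m F)%:R ^+ 2) - EX n p m ^+ 2.
Proof.
move=> p01; have [mu muE] : exists mu, mu = EX n p m by exists (EX n p m).
rewrite -muE.
apply: (@le_trans _ _
  (\sum_(F : set_family n) rss_mass p F * ((num_hitting m F)%:R - mu) ^+ 2)).
  rewrite mulr_suml big_mkcond /=; apply: ler_sum => F _.
  have mass0 := rss_mass_ge0 F p01.
  case: ifP => [/eqP->|_]; first by rewrite sub0r sqrrN.
  by rewrite mulr_ge0 ?sqr_ge0.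
rewrite le_eqVlt; apply/orP; left; apply/eqP.
transitivity (rss_expectation p (fun F : set_family n => (num_hitting m F)%:R ^+ 2)
   - 2 * mu * EX n p m + mu ^+ 2 * \sum_(F : set_family n) rss_mass p F); last first.
  by rewrite sum_rss_mass -muE; ring.
rewrite /EX /rss_expectation !mulr_sumr -sumrB -big_split /=.
by apply: eq_bigr => F _; ring.
Qed.

(** Markov's inequality at level 1. *)
Lemma rss_prob_num_hitting_gt0 (R : realType) (n m : nat) (p : R) : 0 <= p <= 1 ->
  rss_prob p (fun F : set_family n => (0 < num_hitting m F)%N) <= EX n p m.
Proof.
move=> p01; rewrite -rss_expectationE; apply: ler_sum => F _.
apply: ler_wpM2l; first exact: rss_mass_ge0.
by rewrite ler_nat; case: num_hitting.
Qed.

(** * The second moment *)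

Lemma bernoulli_ineq (R : realType) (x : R) (m : nat) : 1 <= x ->
  1 + m%:R * (x - 1) <= x ^+ m.
Proof.
move=> x1; elim: m => [|m IHm]; first by rewrite mul0r addr0 expr0.
have xm1 : 1 <= x ^+ m by rewrite exprn_ege1.
rewrite exprS -natr1; nra.
Qed.

(** The excess [q ^ (-r)] is at most [q ^ (-N / 2) <= C ^ (1/2)], and [B M] is at most another
    [C ^ (1/2)]. Squaring keeps the exponents integral. *)
Lemma pair_weight_close (R : realType) (q : R) (N r C B M : nat) :
  0 < q < 1 -> 1 <= C%:R * q ^+ N -> (2 * r <= N)%N -> ((B * M) ^ 2 <= C)%N ->
  q ^+ (N + N - r) * (B * M)%:R <= C%:R * q ^+ (N + N).
Proof.
move=> /andP[q0 q1] Cq rN BMC.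
have qge0 k : 0 <= q ^+ k by rewrite exprn_ge0 // ltW.
rewrite -(@ler_pXn2r _ 2) ?nnegrE ?mulr_ge0 // !exprMn -!exprM -natrX.
apply: (@le_trans _ _ (q ^+ (3 * N) * C%:R)).
  apply: ler_pM => //; last by rewrite ler_nat.
  by apply: ler_wiXn2l; [exact: ltW | exact: ltW | lia].
rewrite (_ : (N + N) * 2 = 3 * N + N)%N; last by lia.
rewrite [leRHS](_ : _ = q ^+ (3 * N) * C%:R * (C%:R * q ^+ N)).
  by rewrite ler_peMr // mulr_ge0.
by rewrite exprD; ring.
Qed.

(** Let [x = q ^ (-r)]. Then [x ^ (L M) <= x ^ e = q ^ (-N) <= C <= 2 ^ L], so [x ^ M <= 2], and
    Bernoulli's inequality gives [x <= 1 + 1/M]. *)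
Lemma pair_weight_far (R : realType) (q : R) (N r e C L M : nat) :
  0 < q < 1 -> 1 <= C%:R * q ^+ N -> (r * e = N)%N -> (0 < M)%N -> (0 < L)%N ->
  (C <= 2 ^ L)%N -> (L * M <= e)%N ->
  q ^+ (N + N - r) <= q ^+ (N + N) * (1 + M%:R^-1).
Proof.
move=> /andP[q0 q1] Cq re M0 L0 CL LMe.
have rN : (r <= N)%N by rewrite -re leq_pmulr //; nia.
have M0R : 0 < M%:R :> R by rewrite ltr0n.
set x := (q ^+ r)^-1.
have qr0 : 0 < q ^+ r by rewrite exprn_gt0.
have x1 : 1 <= x by rewrite invf_ge1 // exprn_ile1 // ltW.
have -> : q ^+ (N + N - r) = q ^+ (N + N) * x.
  by rewrite -[in RHS](subnK (_ : r <= N + N)%N) ?exprD ?mulfK ?gt_eqF //; lia.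
rewrite ler_wpM2l ?exprn_ge0 ?(ltW q0) //.
have xM : x ^+ M <= 2.
  rewrite -(@ler_pXn2r _ L) ?nnegrE ?exprn_ge0 ?(le_trans ler01 x1) //.
  apply: le_trans (_ : C%:R <= _); last by rewrite -natrX ler_nat.
  rewrite -exprM mulnC (le_trans (ler_weXn2l x1 LMe)) //.
  by rewrite exprVn -exprM re -div1r ler_pdivrMr // exprn_gt0.
have := le_trans (bernoulli_ineq M x1) xM.
rewrite -lerBrDl -[X in _ <= X -> _]/(2 - 1) (_ : 2 - 1 = 1); last by ring.
by rewrite mulrC -ler_pdivlMr // div1r lerBlDl.
Qed.

(** [T] is determined by what it drops from [S] and what it adds; as the cardinalities agree, both
    parts have size [j]. *)
Lemma card_dist_eq (n j : nat) (S : {set 'I_n}) :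
  (#|[set T : {set 'I_n} | (#|T| == #|S|) && (#|T :\: S| == j)]%SET|
    <= (#|S| * (n - #|S|)) ^ j)%N.
Proof.
set X := finset _.
pose f (T : {set 'I_n}) := (S :\: T, T :\: S).
have f_inj : injective f.
  move=> T1 T2 [e1 e2]; apply/setP => x.
  have /setP/(_ x) := e1; have /setP/(_ x) := e2; rewrite !inE.
  by case: (x \in S) (x \in T1) (x \in T2) => [] [] [].
pose draws (A : {set 'I_n}) := [set B : {set 'I_n} | B \subset A & #|B| == j]%SET.
rewrite -(card_imset _ f_inj).
apply: leq_trans (_ : #|finset.setX (draws S) (draws (~: S))| <= _)%N.
  apply/subset_leq_card/fintype.subsetP => _ /imsetP[T + ->].
  rewrite !inE /= => /andP[/eqP cTS /eqP cj]; rewrite subsetDl cj eqxx.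
  rewrite [in X in X && true]finset.setDE finset.subsetIr !andbT; apply/eqP.
  by rewrite -cj !cardsD cTS finset.setIC.
rewrite cardsX !cards_draws [#|~: S|]cardsCs finset.setCK card_ord expnMn.
by rewrite leq_mul ?bin_leq_expn.
Qed.

(** As the base is at least 2, each power of it absorbs the sum of the lower ones. *)
Lemma card_dist_lt (n J : nat) (S : {set 'I_n}) : (2 <= #|S| * (n - #|S|))%N ->
  (#|[set T : {set 'I_n} | (#|T| == #|S|) && (#|T :\: S| < J)%N]%SET|
    <= (#|S| * (n - #|S|)) ^ J)%N.
Proof.
move=> D2; elim: J => [|J IHJ].
  by rewrite (_ : finset _ = finset.set0) ?cards0 //; apply/setP => T; rewrite !inE andbF.
apply: leq_trans (_ : 2 * (#|S| * (n - #|S|)) ^ J <= _)%N; last by rewrite expnS leq_mul2r D2 orbT.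
rewrite mul2n -addnn (leq_trans _ (leq_add IHJ (card_dist_eq J S))) //.
rewrite (leq_trans _ (leq_card_setU _ _)) // subset_leq_card //.
apply/fintype.subsetP => T; rewrite !inE ltnS leq_eqVlt => /andP[-> /=].
by rewrite orbC.
Qed.

Lemma card_setU_setD (T : finType) (A B : {set T}) :
  #|A :|: B| = (#|A| + #|B :\: A|)%N.
Proof.
apply: (@addIn #|A :&: B|).
by rewrite cardsUI -addnA [(_ + #|A :&: B|)%N]addnC finset.setIC finset.cardsID.
Qed.

(** The three terms [1 / M] come from the diagonal [T = S], from the close pairs and from the excess
    of the far pairs. *)
Lemma second_moment_le (R : realType) (n m M : nat) (p : R) :
  0 < p < 1 -> (0 < M)%N -> (m <= n)%N -> (2 <= m * (n - m))%N -> spread M n m ->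
  M%:R <= EX n p m ->
  rss_expectation p (fun F : set_family n => (num_hitting m F)%:R ^+ 2) <=
    EX n p m ^+ 2 * (1 + 3 / M%:R).
Proof.
move=> p01 M0 m_le D2 [J [L [J0 L0 CL LMJ BMC]]]; rewrite EX_E second_moment_E.
have : 0 < 1 - p < 1 by move: p01; lra.
set q := 1 - p; set N := (2 ^ (n - m))%N; set C := 'C(n, m); set D := (m * (n - m))%N.
move=> q01 MEX; have /andP[q0 q1] := q01.
have MR0 : 0 < M%:R :> R by rewrite ltr0n.
have EX1 : 1 <= C%:R * q ^+ N by apply: le_trans MEX; rewrite ler1n.
have BR0 : 0 < (D ^ J)%:R :> R by rewrite ltr0n expn_gt0 (ltnW D2).
have q2N : 0 <= q ^+ (N + N) by rewrite exprn_ge0 // ltW.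
pose close := C%:R * q ^+ (N + N) / (D ^ J * M)%:R.
pose far := q ^+ (N + N) * (1 + M%:R^-1).
(* One bound valid for every pair, so that the double sum separates; [close] is scaled so that
   [D ^ J] copies of it make [C q ^ (2 N) / M]. *)
have pair (S T : {set 'I_n}) : #|S| = m -> #|T| = m ->
    q ^+ (N + N - 2 ^ (n - #|S :|: T|)) <=
    (T == S)%:R * q ^+ N + (#|T :\: S| < J)%:R * close + far.
  move=> Sm Tm.
  have far0 : 0 <= far by rewrite mulr_ge0 // addr_ge0 // invr_ge0 ltW.
  have close0 : 0 <= close by rewrite mulr_ge0 ?invr_ge0 ?mulr_ge0.
  have qN0 : 0 <= q ^+ N by rewrite exprn_ge0 // ltW.
  have cU : #|S :|: T| = (m + #|T :\: S|)%N.
    by rewrite card_setU_setD Sm.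
  have Un : (m + #|T :\: S| <= n)%N.
    by rewrite -cU -[X in (_ <= X)%N]card_ord max_card.
  rewrite {}cU; have [j0|j0] := posnP #|T :\: S|.
    have -> : T == S.
      by rewrite eqEcard Sm Tm leqnn andbT -finset.setD_eq0 -cards_eq0 j0.
    by rewrite j0 addn0 addnK mul1r -addrA lerDl addr_ge0 ?mulr_ge0.
  have [jJ|Jj] := ltnP #|T :\: S| J.
    rewrite mul1r; apply: (@le_trans _ _ close).
      rewrite ler_pdivlMr ?natrM ?mulr_gt0 // -natrM.
      apply: pair_weight_close => //; last by rewrite expnMn -expnM mulnC (mulnC J).
      by rewrite -expnS leq_exp2l //; clear -Un j0; lia.
    by rewrite addrAC lerDr addr_ge0 ?mulr_ge0.
  rewrite mul0r addr0; apply: (@le_trans _ _ far).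
    apply: (@pair_weight_far _ _ _ _ (2 ^ #|T :\: S|) C L) => //.
      by rewrite -expnD subnDA subnK //; clear -Un; lia.
    by rewrite (leq_trans LMJ) // leq_exp2l.
  by rewrite lerDr mulr_ge0.
apply: (@le_trans _ _ (\sum_(S : {set 'I_n} | #|S| == m)
    (q ^+ N + (D ^ J)%:R * close + C%:R * far))).
  apply: ler_sum => S /eqP Sm.
  apply: (@le_trans _ _ (\sum_(T : {set 'I_n} | #|T| == m)
      ((T == S)%:R * q ^+ N + (#|T :\: S| < J)%:R * close + far))).
    by apply: ler_sum => T /eqP Tm; apply: pair.
  rewrite !big_split /= -!mulr_suml; apply: lerD; [apply: lerD|].
  - rewrite (bigD1 S) ?Sm //= eqxx big1 ?addr0 ?mul1r //.
    by move=> T /andP[_ /negPf->].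
  - rewrite ler_wpM2r ?mulr_ge0 ?invr_ge0 //.
    rewrite -natr_sum ler_nat -big_mkcondr sum1_card.
    have := @card_dist_lt n J S; rewrite Sm => /(_ D2); by rewrite cardsE.
  - by rewrite mulr_suml sumr_const -cardsE card_sized_sets card_ord mulr_natl.
rewrite sumr_const -cardsE card_sized_sets card_ord -/C -[_ *+ C]mulr_natl /close /far.
rewrite natrM invfM exprD; set x := q ^+ N in MEX *.
rewrite [leLHS](_ : _ = C%:R * x + (C%:R * x) ^+ 2 * (1 + 2 / M%:R)); last first.
  by field; rewrite !gt_eqF.
set y := C%:R * x in MEX *.
(* The diagonal contributes the mean [y] itself; [y >= M] makes this a [1 / M] fraction of
   [y ^ 2]. *)
have y_le : y <= y ^+ 2 / M%:R.
  by rewrite ler_pdivlMr // expr2 ler_pM2l // (lt_le_trans MR0).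
rewrite (_ : 3 / M%:R = 2 / M%:R + M%:R^-1); last by field; rewrite gt_eqF.
by move: y_le; nra.
Qed.

(** * Thresholds *)

Lemma ln_nat_ge (R : realType) (B : R) :
  exists n0, forall n, (n0 <= n)%N -> B <= ln (n%:R : R).
Proof.
exists (Num.bound (expR B)) => n n_ge.
have B_le : expR B <= n%:R.
  by rewrite ltW // (lt_le_trans (archi_boundP (expR_ge0 B))) // ler_nat.
by rewrite -[leLHS]expRK ler_ln ?posrE ?expR_gt0 // (lt_le_trans (expR_gt0 B)).
Qed.

Lemma leq_expn2_log (R : realType) (x : R) (m k : nat) :
  0 < x -> k%:R / ln 2 * ln x <= m%:R -> x ^+ k <= 2 ^+ m.
Proof.
move=> x0; have ln2 : 0 < ln (2 : R) by rewrite ln_gt0 // ltr1n.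
rewrite mulrAC ler_pdivrMr // => log_le.
have : expR (k%:R * ln x) <= expR (m%:R * ln 2) by rewrite ler_expR.
by rewrite !expRM_natl !lnK ?posrE.
Qed.

(** For large [n] the bit length is at most [(ln n) ^ 2], so its eighth power is at most
    [(ln n) ^ 16], which is at most [2 ^ k] once [k >= (16 / ln 2) ln (ln n)]. At the upper end,
    [ln (ln n) <= ln n] suffices. *)
Lemma inner_size_in_window (R : realType) : exists n0, forall n m, (n0 <= n)%N ->
  (m <= n)%N -> in_window (16 / ln (2 : R)) (16 / ln 2) n m -> inner_size n m.
Proof.
have ln2 : 0 < ln (2 : R) by rewrite ln_gt0 // ltr1n.
have [n0 n0P] := ln_nat_ge (2 / ln 2 + ln 2 + 1 : R).
exists n0.+1 => n m n_ge m_le /andP[m_ge]; rewrite lerBrDr -lerBrDl => m_le'.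
rewrite /inner_size m_le /=; set T := bit_length n.
have n_gt0 : (0 < n)%N by apply: leq_trans n_ge.
have := n0P n (ltnW n_ge); set x := ln n%:R in m_ge m_le' * => x_ge.
have lnn0 : 0 < 2 / ln 2 :> R by rewrite divr_gt0.
have x0 : 0 < x by lra.
have T_le : T%:R <= x ^+ 2.
  have : (T.-1)%:R * ln 2 <= x.
    rewrite mulr_natl -lnXn // ler_ln ?posrE ?exprn_gt0 ?ltr0n //.
    by rewrite -natrX ler_nat expn2_bit_length_leq.
  have -> : T%:R = (T.-1)%:R + 1 :> R by rewrite natr1.
  move=> T1; have T2 : (T.-1)%:R + 1 <= 2 / ln 2 * x.
    by rewrite mulrAC ler_pdivlMr //; lra.
  by apply: le_trans T2 _; rewrite expr2 ler_pM2r //; lra.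
have T8 k : 16 / ln 2 * ln x <= k%:R -> (T ^ 8 <= 2 ^ k)%N.
  move=> /(leq_expn2_log x0); rewrite -(ler_nat R) !natrX; apply: le_trans.
  by rewrite (exprM x 2 8) lerXn2r ?nnegrE ?sqr_ge0 ?ler0n.
have [_|_] := leqP m (n - m); apply: T8 => //.
rewrite natrB // (le_trans _ m_le') // ler_wpM2l ?divr_ge0 ?(ltW ln2) //.
by have := le_ln1Dx (_ : -1 < x - 1); rewrite [1 + _]addrC subrK => /(_ _); lra.
Qed.

(** [minn m (n - m)] is concave in [m], hence smallest at an endpoint of the interval. *)
Lemma inner_size_between (n a b m : nat) : inner_size n a -> inner_size n b ->
  (a <= m <= b)%N -> inner_size n m.
Proof.
rewrite /inner_size => /andP[an ia] /andP[bn ib] /andP[am mb].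
rewrite (leq_trans mb bn) /=.
have [|] : (minn a (n - a) <= minn m (n - m) \/ minn b (n - b) <= minn m (n - m))%N by lia.
  by move=> le; rewrite (leq_trans ia) // leq_exp2l.
by move=> le; rewrite (leq_trans ib) // leq_exp2l.
Qed.

(** * Growth of the expectation with the size *)

(** A step from [m] to [m + 1] halves [2 ^ (n - m)], so the mean at [m] and the squared mean at
    [m + 1] carry the same power of [1 - p]. *)
Lemma EX_succ (R : realType) (n m : nat) (p : R) : (m < n)%N ->
  'C(n, m.+1)%:R ^+ 2 * EX n p m = 'C(n, m)%:R * EX n p m.+1 ^+ 2.
Proof.
move=> mn; rewrite !EX_E exprMn -exprM mulrCA; congr (_ * (_ * _ ^+ _)).
by rewrite mulnC -expnS subnSK.
Qed.

(** By [EX_succ] the ratio of the two sides is governed by [C(n, m+1) ^ 2 / C(n, m)], which is at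
    least [C(n, m) / n ^ 2 >= n ^ 4]. *)
Lemma EX_succ_ge (R : realType) (n m : nat) (p : R) : 0 < p < 1 -> (m < n)%N ->
  (n ^ 6 <= 'C(n, m))%N -> n%:R ^+ 4 * EX n p m <= EX n p m.+1 ^+ 2.
Proof.
move=> /andP[p0 p1] mn Cn.
have n0 : 0 < n%:R :> R by rewrite ltr0n (leq_trans _ mn).
have C0 : 0 < 'C(n, m)%:R :> R by rewrite ltr0n bin_gt0 ltnW.
have EX0 : 0 <= EX n p m by rewrite EX_E mulr_ge0 // exprn_ge0 //; lra.
have CS : 'C(n, m)%:R <= n%:R * 'C(n, m.+1)%:R :> R.
  rewrite -natrM ler_nat (@leq_trans (m.+1 * 'C(n, m.+1))) ?leq_mul //.
  by rewrite mul_bin_left leq_pmull // subn_gt0.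
rewrite -(ler_pM2l (_ : 0 < 'C(n, m)%:R * n%:R ^+ 2)) ?mulr_gt0 ?exprn_gt0 //.
apply: (@le_trans _ _ ('C(n, m)%:R * ('C(n, m)%:R * EX n p m))).
  rewrite -[leLHS]mulrA ler_pM2l // mulrA ler_wpM2r // -exprD -natrX.
  by rewrite ler_nat.
rewrite mulrAC -EX_succ // [leRHS]mulrAC mulrA ler_wpM2r // -exprMn -[leLHS]expr2.
by rewrite lerXn2r ?nnegrE ?mulr_ge0 // mulrC.
Qed.

(** Iterates [EX_succ_ge]. If [h <= l], it would carry the large mean at [h] up to [l], where the
    mean tends to 0. *)
Lemma EX_ge1_le (R : realType) (n a b : nat) (p : R) : 0 < p < 1 ->
  (a <= b < n)%N -> (forall m, (a <= m <= b)%N -> (n ^ 6 <= 'C(n, m))%N) ->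
  1 <= EX n p a -> 1 <= EX n p b.
Proof.
move=> p01 /andP[]; elim: b => [|b IHb]; first by rewrite leqn0 => /eqP->.
rewrite leq_eqVlt => /predU1P[->//|ab] bn big EXa.
have EXb : 1 <= EX n p b.
  apply: IHb => //; first exact: ltnW.
  by move=> m /andP[am mb]; apply: big; rewrite am (leqW mb).
have big_b : (n ^ 6 <= 'C(n, b))%N by apply: big; rewrite -ltnS ab leqnSn.
have EXS := EX_succ_ge p01 (ltnW bn) big_b.
have EX0 : 0 <= EX n p b.+1.
  by rewrite EX_E mulr_ge0 // exprn_ge0 //; move: p01; lra.
rewrite -(@ler_pXn2r _ 2) ?nnegrE // expr1n (le_trans _ EXS) //.
rewrite mulr_ege1 // exprn_ege1 // ler1n.
by case: (n) bn.
Qed.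

(** * From counts of hitting sets to the minimum size *)

(** Hitting is inherited by supersets: add [m - #|S|] points of the complement to [S]. *)
Lemma num_hitting_gt0 (n m : nat) (F : set_family n) (S : {set 'I_n}) :
  (#|S| <= m <= n)%N -> hitting F S -> (0 < num_hitting m F)%N.
Proof.
move=> /andP[Sm mn] hit.
have : (0 < #|[set B : {set 'I_n} | B \subset ~: S & #|B| == m - #|S|]%SET|)%N.
  by rewrite cards_draws bin_gt0 [#|~: S|]cardsCs finset.setCK card_ord leq_sub2r.
case/card_gt0P => B; rewrite inE => /andP[BS /eqP cB].
apply/card_gt0P; exists (S :|: B); rewrite inE card_setU_setD.
have /finset.setDidPl-> : [disjoint B & S] by rewrite finset.disjoints_subset.
rewrite cB subnKC // eqxx /=; apply/forall_inP => A /(forall_inP hit) /leq_trans.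
by apply; rewrite subset_leq_card // finset.setIS // finset.subsetUl.
Qed.

(** Every hitting set has more than [l] points, as a smaller one would extend to size [l]. If size
    [l + 1] occurs it is minimal; if not, all sizes are at least [l + 2 >= h]. *)
Lemma min_hitting_size_threshold (n l h : nat) (F : set_family n) :
  (l <= n)%N -> h = (l + 1)%N \/ h = (l + 2)%N ->
  num_hitting l F = 0%N -> (0 < num_hitting h F)%N ->
  min_hitting_size F (l + 1) || min_hitting_size F h.
Proof.
move=> ln hl Xl /card_gt0P[S]; rewrite inE => hitS.
have none (T : {set 'I_n}) : hitting F T -> (l < #|T|)%N.
  move=> hitT; rewrite ltnNge; apply/negP => Tl.
  by have := @num_hitting_gt0 n l F T; rewrite Tl ln Xl => /(_ isT hitT).
have no_lt k : (forall T : {set 'I_n}, hitting F T -> (k <= #|T|)%N) ->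
    ~~ [exists T : {set 'I_n}, (#|T| < k)%N && hitting F T].
  move=> kT; apply/existsPn => T; rewrite negb_and -leqNgt.
  by case: (boolP (hitting F T)) => [/kT->|]; rewrite ?orbT.
rewrite /min_hitting_size.
have [ex1|/existsPn noT] :=
  boolP [exists T : {set 'I_n}, (#|T| == l + 1)%N && hitting F T].
  by rewrite no_lt // => T /none; rewrite addn1.
have -> : [exists T : {set 'I_n}, (#|T| == h) && hitting F T].
  by apply/existsP; exists S.
rewrite (no_lt h) /= ?orbT // => T hitT.
have := none T hitT; have := noT T; rewrite hitT andbT => /eqP.
by case: hl => ->; move: #|T| => t; clear; lia.
Qed.

(** Union bound: failure requires a hitting set of size [l] (Markov) or none of size [h]
    (Chebyshev). *)
Lemma rss_prob_threshold_ge (R : realType) (n l h M : nat) (p : R) :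
  0 < p < 1 -> (l <= n)%N -> h = (l + 1)%N \/ h = (l + 2)%N -> (0 < M)%N ->
  (h <= n)%N -> (2 <= h * (n - h))%N -> spread M n h -> M%:R <= EX n p h ->
  1 - (EX n p l + 3 / M%:R) <=
  rss_prob p (fun F : set_family n =>
    min_hitting_size F (l + 1)%N || min_hitting_size F h).
Proof.
move=> p01 ln hl M0 hn D2 sp EXh.
have p01' : 0 <= p <= 1 by move: p01; lra.
have EX0 : 0 < EX n p h by rewrite (lt_le_trans _ EXh) // ltr0n.
have Xh : rss_prob p (fun F : set_family n => num_hitting h F == 0%N) <= 3 / M%:R.
  rewrite -(ler_pM2r (exprn_gt0 2 EX0)).
  apply: (le_trans (rss_prob_num_hitting_eq0 n h p01')).
  rewrite lerBlDr (le_trans (second_moment_le p01 M0 hn D2 sp EXh)) //.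
  by rewrite mulrDr mulr1 addrC [_ * (3 / _)]mulrC.
have Xl := rss_prob_num_hitting_gt0 n l p01'.
rewrite lerBlDr; apply: le_trans (lerD (lexx _) (lerD Xl Xh)).
rewrite -(sum_rss_mass n p) -!rss_expectationE /rss_expectation -!big_split /=.
apply: ler_sum => F _; rewrite -!mulrDr ler_peMr ?rss_mass_ge0 //.
have [E|nE] := boolP (_ || _); first by rewrite lerDl addr_ge0.
have [_|Xh0] := eqVneq (num_hitting h F) 0%N; first by rewrite addrA lerDr addr_ge0.
have [Xl0|Xl0] := posnP (num_hitting l F); last by rewrite addr0 add0r.
by rewrite (min_hitting_size_threshold ln hl Xl0) ?lt0n in nE.
Qed.

Local Open Scope classical_set_scope.
Local Open Scope ring_scope.

(** Raising [l] by one wherever the claim fails keeps the means tending to 0, so by maximality this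
    happens only finitely often. *)
Lemma ell_succ_gt (R : realType) (p : nat -> R) (l : nat -> nat) (d : nat -> R) :
  is_ell p l -> d n @[n --> \oo] --> (0 : R) ->
  (forall n, (1 <= n)%N -> 0 < p n < 1) ->
  \forall n \near \oo, (l n < n)%N -> d n < EX n (p n) (l n).+1.
Proof.
move=> [l_le EXl l_max] d0 p01.
pose low n := (l n < n)%N && (EX n (p n) (l n).+1 <= d n).
pose m n := if low n then (l n).+1 else l n.
have EXm : EX n (p n) (m n) @[n --> \oo] --> (0 : R).
  apply/cvgrPdist_le => e e0; near=> n.
  have n1 : (1 <= n)%N by near: n; exact: nbhs_infty_ge.
  have EX0 k : 0 <= EX n (p n) k.
    by rewrite EX_E mulr_ge0 // exprn_ge0 //; have := p01 n n1; lra.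
  rewrite sub0r normrN ger0_norm // /m; case: ifP => [/andP[_ low_n]|_].
    apply: le_trans low_n _; apply: le_trans (ler_norm _) _.
    by rewrite -normrN -sub0r; near: n; exact: (cvgr_dist_le _ _ d0 _ e0).
  by rewrite -(ger0_norm (EX0 _)) -normrN -sub0r; near: n; exact: (cvgr_dist_le _ _ EXl _ e0).
have m_le : size_sequence m.
  by move=> n; rewrite /m; case: ifP => // /andP[].
have := l_max m m_le EXm; apply: filterS => n mn ln.
by rewrite ltNge; apply/negP => low_n; move: mn; rewrite /m /low ln low_n ltnn.
Unshelve. all: by end_near.
Qed.

Theorem theorem1 (R : realType) :
  exists C1 C2 : R, [/\ 0 < C1, 0 < C2 &
    forall (p : nat -> R) (l h : nat -> nat),
      (forall n : nat, (1 <= n)%N -> 0 < p n < 1) ->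
      suitable C1 C2 p l h ->
      (\forall n \near \oo, h n = (l n + 1)%N \/ h n = (l n + 2)%N) /\
      rss_prob (p n) (fun F : set_family n =>
          min_hitting_size F (l n + 1)%N || min_hitting_size F (h n))
        @[n --> \oo] --> (1 : R)].
Proof.
have C_gt0 : 0 < 16 / ln 2 :> R by rewrite divr_gt0 // ln_gt0 // ltr1n.
exists (16 / ln 2), (16 / ln 2); split=> // p l h p01 [ell hh window].
have [l_le EXl _] := ell; have [h_le EXh h_min] := hh.
have [n1 n1P] := inner_size_in_window R.
have inner : \forall n \near \oo, inner_size n (l n) /\ inner_size n (h n).
  near=> n; have n_ge : (n1 <= n)%N by near: n; exact: nbhs_infty_ge.
  have [] : in_window (16 / ln (2 : R)) (16 / ln 2) n (l n) /\
            in_window (16 / ln (2 : R)) (16 / ln 2) n (h n) by near: n.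
  by move=> wl wh; split; apply: n1P.
(* The value 1 is arbitrary: [n2] supplies [n ^ 6 <= C(n, m)], while the second moment later takes
   an [M] depending on [e]. The 2 keeps inner sizes at distance at least 2 from 0 and [n]. *)
have [n2 n2P] := spread_inner 1; have [n3 n3P] := bit_length_inner 2.
have EXl_lt1 : \forall n \near \oo, EX n (p n) (l n) < 1.
  near=> n; rewrite (le_lt_trans (ler_norm _)) // -normrN -sub0r.
  by near: n; exact: (cvgr_dist_lt _ _ EXl _ ltr01).
have EXh_ge (A : R) : \forall n \near \oo, A <= EX n (p n) (h n).
  by move: A; apply/cvgryPge.
have lh : \forall n \near \oo, (l n < h n)%N.
  near=> n; rewrite ltnNge; apply/negP => hl.
  have n_gt0 : (1 <= n)%N by near: n; exact: nbhs_infty_ge.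
  have n_ge2 : (n2 <= n)%N by near: n; exact: nbhs_infty_ge.
  have n_ge3 : (n3 <= n)%N by near: n; exact: nbhs_infty_ge.
  have [inl inh] : inner_size n (l n) /\ inner_size n (h n) by near: n.
  have : 1 <= EX n (p n) (l n).
    apply: (@EX_ge1_le _ _ (h n)) => //; first exact: p01.
    - by rewrite hl; have [_] := n3P _ _ n_ge3 inl; lia.
    - by move=> m hml; have [] := n2P n m n_ge2 (inner_size_between inh inl hml).
    - by near: n.
  by apply/negP; rewrite -ltNge; near: n.
have inv0 : (n%:R : R)^-1 @[n --> \oo] --> (0 : R).
  apply/(gtr0_cvgV0 (f := fun n => n%:R : R)); last exact: cvgr_idn.
  by near=> n; rewrite ltr0n; near: n; exact: nbhs_infty_gt.
have EXl1 := ell_succ_gt ell inv0 p01.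
have hl2 : \forall n \near \oo, (h n <= l n + 2)%N.
  (* Minimality of [h] is tested on a sequence bounded by [n] for every [n]; the cap is inactive for
     large [n]. *)
  have : \forall n \near \oo, (h n <= minn (l n + 2) n)%N.
    apply: h_min; first by move=> n; rewrite geq_minr.
    apply: ger_cvgy (@cvgr_idn R); near=> n.
    have n_gt0 : (1 <= n)%N by near: n; exact: nbhs_infty_ge.
    have n_ge2 : (n2 <= n)%N by near: n; exact: nbhs_infty_ge.
    have n_ge3 : (n3 <= n)%N by near: n; exact: nbhs_infty_ge.
    have [inl inh] : inner_size n (l n) /\ inner_size n (h n) by near: n.
    have lhn : (l n < h n)%N by near: n.
    have l1n : ((l n).+1 < n)%N by have [_] := n3P _ _ n_ge3 inh; lia.
    have inl1 : inner_size n (l n).+1.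
      by apply: inner_size_between inl inh _; rewrite leqnSn.
    have [_ Cn] := n2P _ _ n_ge2 inl1.
    have l1 : n%:R^-1 < EX n (p n) (l n).+1.
      by move: (ltnW l1n); near: n.
    have nR1 : 1 <= n%:R :> R by rewrite ler1n.
    have nR0 : 0 < n%:R :> R by rewrite ltr0n.
    have -> : minn (l n + 2) n = (l n).+2 by lia.
    have EX0 : 0 <= EX n (p n) (l n).+2.
      by rewrite EX_E mulr_ge0 // exprn_ge0 //; have := p01 n n_gt0; lra.
    rewrite -(@ler_pXn2r _ 2) ?nnegrE ?(ltW nR0) //.
    apply: le_trans (EX_succ_ge (p01 n n_gt0) l1n Cn).
    (* The squared mean at [l + 2] is at least [n ^ 4 / n = n ^ 3 >= n ^ 2]. *)
    apply: (@le_trans _ _ (n%:R ^+ 4 * n%:R^-1)).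
      by rewrite (exprSr _ 3) mulfK ?gt_eqF // ler_weXn2l.
    by rewrite ler_wpM2l ?exprn_ge0 // ltW.
  by apply: filterS => n; rewrite leq_min => /andP[].
have hl : \forall n \near \oo, h n = (l n + 1)%N \/ h n = (l n + 2)%N.
  near=> n.
  have lhn : (l n < h n)%N by near: n.
  have hln : (h n <= l n + 2)%N by near: n.
  by clear -lhn hln; lia.
split=> //; apply/cvgrPdist_le => e e0.
(* Half of [e] pays for the second moment error [3 / M], the other half for the mean at [l]. *)
have [M M_gt0 M_e] : exists2 M : nat, (0 < M)%N & 3 / (M%:R : R) <= e / 2.
  exists (Num.bound (6 / e)).+1 => //; rewrite ler_pdivrMr ?ltr0n //.
  have : 6 / e < (Num.bound (6 / e)).+1%:R.
    by rewrite (lt_le_trans (archi_boundP _)) ?divr_ge0 ?(ltW e0) // ler_nat.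
  by rewrite ltr_pdivrMr //; lra.
have [n4 n4P] := spread_inner M.
near=> n.
have n_gt0 : (1 <= n)%N by near: n; exact: nbhs_infty_ge.
have n_ge3 : (n3 <= n)%N by near: n; exact: nbhs_infty_ge.
have n_ge4 : (n4 <= n)%N by near: n; exact: nbhs_infty_ge.
have [inl inh] : inner_size n (l n) /\ inner_size n (h n) by near: n.
have hln : h n = (l n + 1)%N \/ h n = (l n + 2)%N by near: n.
have [sp _] := n4P _ _ n_ge4 inh.
have EXl_e : EX n (p n) (l n) <= e / 2.
  apply: le_trans (ler_norm _) _; rewrite -normrN -sub0r.
  by near: n; apply: (cvgr_dist_le _ _ EXl); rewrite divr_gt0.
have D2 : (2 <= h n * (n - h n))%N.
  by have [_] := n3P _ _ n_ge3 inh; rewrite leq_min => /andP[? ?]; rewrite -[2%N]muln1 leq_mul // ltnW.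
have EXhM : M%:R <= EX n (p n) (h n) by near: n.
have prob_ge := rss_prob_threshold_ge (p01 n n_gt0) (l_le n) hln M_gt0 (h_le n) D2 sp EXhM.
have prob_le := rss_prob_le1 (fun F : set_family n =>
    min_hitting_size F (l n + 1)%N || min_hitting_size F (h n)) (p01 n n_gt0).
rewrite ger0_norm; first by move: prob_ge EXl_e M_e; lra.
by move: prob_le; lra.
Unshelve. all: by end_near.
Qed.
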